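(* Let $M_1\in\mathbb{R}^{n_1\times n_1}$ and $M_2\in\mathbb{R}^{n_2\times n_2}$ be symmetric positive definite and tridiagonal matrices, and let $S_g=M_1\otimes I_{n_2}+I_{n_1}\otimes M_2$. Let $$\delta_{1,2}=(\lambda_{\max}(M_1)-\lambda_{\min}(M_1))\,(\lambda_{\max}(M_2)-\lambda_{\min}(M_2)) .$$ For $k,t\in\{1,\ldots,n_1n_2\}$ let $$i=\lfloor (t-1)/n_2\rfloor+1,\quad j=t-n_2\lfloor (t-1)/n_2\rfloor,\quad \ell=\lfloor (k-1)/n_2\rfloor+1,\quad m=k-n_2\lfloor (k-1)/n_2\rfloor$$ be such that $\ell\ne i$ and $m\ne j$. Then $$|(S_g^{-1})_{k,t}|\le\frac{1}{2\pi}\,\frac{64}{\delta_{1,2}}\int_{-\infty}^{\infty}\frac{R_1^2}{(R_1^2-1)^2}\,\frac{R_2^2}{(R_2^2-1)^2}\left(\frac{1}{R_1}\right)^{|i-\ell|-1}\left(\frac{1}{R_2}\right)^{|j-m|-1}\,d\omega ,$$ where $R_1=R_1(\omega)$ and $R_2=R_2(\omega)$ are the functions associated with the spectra of $M_1$ and $M_2$, respectively, as defined in the context.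
   Context: $I_n$ is the $n\times n$ identity matrix, $\otimes$ is the Kronecker product, and $\lambda_{\min}(\cdot)$, $\lambda_{\max}(\cdot)$ denote the smallest and largest eigenvalues of a symmetric matrix. For $s\in\{1,2\}$ and $\omega\in\mathbb{R}$ put $\lambda_1^{(s)}=\lambda_{\min}(M_s)+\imath\omega$, $\lambda_2^{(s)}=\lambda_{\max}(M_s)+\imath\omega$ (with $\imath^2=-1$), $$\alpha_s=\alpha_s(\omega)=\frac{|\lambda_1^{(s)}|+|\lambda_2^{(s)}|}{|\lambda_2^{(s)}-\lambda_1^{(s)}|},\qquad R_s=R_s(\omega)=\alpha_s+\sqrt{\alpha_s^2-1}>1 .$$ (The definition of $\alpha_s$ presupposes $\lambda_{\max}(M_s)\neq\lambda_{\min}(M_s)$.) *)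

(* Defs.v *)
From mathcomp Require Import all_boot all_order all_algebra.
From mathcomp Require Import complex mxtens.
From mathcomp Require Import all_classical all_reals all_analysis.

Set Implicit Arguments.
Unset Strict Implicit.
Unset Printing Implicit Defensive.

Import Order.TTheory GRing.Theory Num.Theory.
Local Open Scope ring_scope.
Local Open Scope classical_set_scope.
Local Open Scope complex_scope.

Definition posdefmx (R : realType) (n : nat) (M : 'M[R]_n) : Prop :=
  forall x : 'cV[R]_n, x != 0 -> 0 < (x^T *m M *m x) 0 0.

Definition tridiagonal (R : realType) (n : nat) (M : 'M[R]_n) : Prop :=
  forall i j : 'I_n, (1 < `|i - j|)%N -> M i j = 0.

(* For M symmetric and n > 0 the set of eigenvalues is finite and nonempty, so
   the infimum and supremum below are attained. *)
Definition lambda_min (R : realType) (n : nat) (M : 'M[R]_n) : R :=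
  inf [set a | eigenvalue M a].

Definition lambda_max (R : realType) (n : nat) (M : 'M[R]_n) : R :=
  sup [set a | eigenvalue M a].

Definition lambda1 (R : realType) (n : nat) (M : 'M[R]_n) (w : R) : R[i] :=
  lambda_min M +i* w.

Definition lambda2 (R : realType) (n : nat) (M : 'M[R]_n) (w : R) : R[i] :=
  lambda_max M +i* w.

(* The norm `|z| of R[i] is R[i]-valued; normc is the R-valued modulus. *)
Definition alpha (R : realType) (n : nat) (M : 'M[R]_n) (w : R) : R :=
  (ComplexField.Normc.normc (lambda1 M w)
     + ComplexField.Normc.normc (lambda2 M w))
  / ComplexField.Normc.normc (lambda2 M w - lambda1 M w).

Definition Rfun (R : realType) (n : nat) (M : 'M[R]_n) (w : R) : R :=
  alpha M w + Num.sqrt (alpha M w ^+ 2 - 1).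

(* The matrix product *t of mxtens is the Kronecker product: with indices
   counted from 0, its row (or column) t is the pair (t %/ n2, t %% n2). *)
Definition kronsum (R : realType) (n1 n2 : nat)
    (M1 : 'M[R]_n1) (M2 : 'M[R]_n2) : 'M[R]_(n1 * n2) :=
  M1 *t (1%:M : 'M[R]_n2) + (1%:M : 'M[R]_n1) *t M2.

Definition delta12 (R : realType) (n1 n2 : nat)
    (M1 : 'M[R]_n1) (M2 : 'M[R]_n2) : R :=
  (lambda_max M1 - lambda_min M1) * (lambda_max M2 - lambda_min M2).

(* Main.v *)
Require Import Defs.
From mathcomp Require Import all_boot all_order all_algebra.
From mathcomp Require Import complex mxtens spectral sesquilinear.
From mathcomp Require Import ring lra zify.
From mathcomp Require Import all_classical all_reals all_analysis.
From mathcomp Require Import measurable_realfun.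

Set Implicit Arguments.
Unset Strict Implicit.
Unset Printing Implicit Defensive.

Import Order.TTheory GRing.Theory Num.Theory.
Import numFieldNormedType.Exports.
Local Open Scope ring_scope.

(** The proof combines an integral representation of the inverse of a Kronecker
    sum with the exponential decay of the inverse of a banded matrix.

    For l, m > 0, the real part of 1 / ((l + iw) (m - iw)) has integral
    2 pi / (l + m) over the real line, as one sees by partial fractions
    ([integral_tensor_kernel]).  Applied to the eigenvalues l of M1 and m of M2,
    in an orthonormal eigenbasis of each matrix ([kronsum_inv_entry]), it gives
    the entry of the inverse of M1 (x) I + I (x) M2 as 1 / (2 pi) times the
    integral of
       Re (G1(w) G2(-w) + G1(-w) G2(w)) / 2,
    where G1(w) and G2(w) are the entries (l, i) of (M1 + iw)^-1 and (m, j) of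
    (M2 + iw)^-1.  Only the real kernel is integrated, and the symmetrisation
    in w replaces the remark that the imaginary part is odd.

    It remains to bound one entry (i, j), i != j, of (M + iw)^-1 for M symmetric,
    tridiagonal, with spectrum in [a, b] ([resolvent_entry_le]).  A polynomial
    p(M) of degree d = |i - j| - 1 vanishes at (i, j), so that the entry is at
    most the sup of |1 / (x + iw) - p(x)| over [a, b]
    ([spectral_weight_poly], [spectral_weight_norm]).  For p one takes a
    Chebyshev expansion whose last coefficient is modified ([resolvent_approx]).
    After rescaling to [-1, 1] the function is 1 / (X - c) with
    2 c = q + 1/q and |q| = r = 1/R < 1.  Writing 2 X = z + 1/z with |z| = 1, the
    remainder beyond degree d consists of the terms q z / (1 - q z) and
    q z^-1 / (1 - q z^-1), multiplied by numbers of modulus r^d.  Both points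
    run over the same circle, whose centre depends on r only ([norm_mobius]);
    moving that centre to 0 costs one multiple of T_d and leaves the radius
    r / (1 - r^2).  Together with the prefactor 2 q / (1 - q^2) of the expansion,
    of modulus at most 2 r / (1 - r^2), it produces the factor
    R^2 / (R^2 - 1)^2 of the statement.

    Integrating this pointwise bound requires the right-hand side to be
    integrable: R^2 / (R^2 - 1)^2 equals 1 / (4 (alpha^2 - 1)), which is
    O(1 / (ab + w^2)) ([decay_factor_le]). *)

(** * Polynomial approximation of 1 / (c - x) on a segment *)

(** The Chebyshev polynomial T_k in the variable (z + 1/z) / 2.  The recurrence
    T_(k+2) = 2 X T_(k+1) - T_k needs two consecutive indices at once. *)
Lemma chebyshev_poly_exists (C : numFieldType) (k : nat) :
  exists2 p : {poly C}, (size p <= k.+1)%N &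
    forall z, z != 0 -> p.[(z + z^-1) / 2] = (z ^+ k + z^-1 ^+ k) / 2.
Proof.
suff: exists p0 p1 : {poly C}, [/\ (size p0 <= k.+1)%N, (size p1 <= k.+2)%N &
    forall z, z != 0 -> p0.[(z + z^-1) / 2] = (z ^+ k + z^-1 ^+ k) / 2 /\
                        p1.[(z + z^-1) / 2] = (z ^+ k.+1 + z^-1 ^+ k.+1) / 2].
  by move=> [p [? [sp _ hp]]]; exists p => // z /hp[].
elim: k => [|k [p0 [p1 [s0 s1 hp]]]].
  exists 1, 'X; split; rewrite ?size_poly1 ?size_polyX// => z z0.
  by rewrite hornerC hornerX !expr0 !expr1; split => //; field.
exists p1, (2 *: ('X * p1) - p0); split => //.
  rewrite (leq_trans (size_polyD _ _))// geq_max size_polyN.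
  rewrite (leq_trans s0) ?andbT; last by rewrite ltnW.
  rewrite (leq_trans (size_scale_leq _ _))// (leq_trans (size_polyMleq _ _))//.
  by rewrite size_polyX.
move=> z z0; have [h0 h1] := hp z z0; split => //.
rewrite !(hornerD, hornerN, hornerZ, hornerM, hornerX) h1 h0 !exprS.
by field.
Qed.

(** Expansion of 1 / (c - x), with 2 c = q + 1/q and 2 x = z + 1/z, in Chebyshev
    polynomials: the coefficient of T_k is proportional to q ^ k, so the tail
    beyond degree d is a geometric series in q z plus one in q / z.  The free
    parameter t, an adjustment of the coefficient of T_d, is tuned later to
    make the remainder as small as possible. *)
Lemma geometric_split (C : numFieldType) (q t : C) (d : nat) :
    q ^+ 2 != 1 -> 
  exists2 p : {poly C}, (size p <= d.+1)%N &
    forall z, z != 0 -> 1 - q * z != 0 -> 1 - q * z^-1 != 0 ->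
    (2 * q) / ((1 - q * z) * (1 - q * z^-1)) = p.[(z + z^-1) / 2] +
      2 * q / (1 - q ^+ 2) * q ^+ d *
        (z ^+ d * (q * z / (1 - q * z) + t)
         + z^-1 ^+ d * (q * z^-1 / (1 - q * z^-1) + t)).
Proof.
move=> q1; have q1' : 1 - q ^+ 2 != 0 by rewrite subr_eq0 eq_sym.
have neq_zq z : z != 0 -> 1 - q * z^-1 != 0 -> z - q != 0.
  move=> z0; apply: contraNneq => h.
  by rewrite -[X in X - _](mulfV z0) -mulrBl h mul0r.
(* The case t = 0 suffices: a nonzero t only changes the coefficient of T_d. *)
suff [p sp hp]: exists2 p : {poly C}, (size p <= d.+1)%N &
    forall z, z != 0 -> 1 - q * z != 0 -> 1 - q * z^-1 != 0 ->
    (2 * q) / ((1 - q * z) * (1 - q * z^-1)) = p.[(z + z^-1) / 2] +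
      2 * q / (1 - q ^+ 2) * q ^+ d *
        (z ^+ d * (q * z / (1 - q * z)) + z^-1 ^+ d * (q * z^-1 / (1 - q * z^-1))).
  have [T sT hT] := chebyshev_poly_exists C d.
  exists (p - (4 * q / (1 - q ^+ 2) * q ^+ d * t) *: T).
    rewrite (leq_trans (size_polyD _ _))// geq_max sp size_polyN.
    by rewrite (leq_trans (size_scale_leq _ _)).
  move=> z z0 h1 h2; rewrite hp// !(hornerD, hornerN, hornerZ) hT//.
  have h3 := neq_zq z z0 h2.
  by field; rewrite z0 q1' h1 h3.
elim: d => [|d [p sp hp]].
  exists (2 * q / (1 - q ^+ 2))%:P; first by rewrite size_polyC; case: eqP.
  move=> z z0 h1 h2; rewrite hornerC !expr0.
  have h3 := neq_zq z z0 h2.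
  by field; rewrite z0 q1' h1 h3.
have [T sT hT] := chebyshev_poly_exists C d.+1.
exists (p + (4 * q / (1 - q ^+ 2) * q ^+ d.+1) *: T).
  rewrite (leq_trans (size_polyD _ _))// geq_max (leq_trans sp)//.
  by rewrite (leq_trans (size_scale_leq _ _)).
move=> z z0 h1 h2; rewrite hp// !(hornerD, hornerN, hornerZ) hT//.
have h3 := neq_zq z z0 h2.
rewrite !exprS; field.
by rewrite z0 q1' h1 h3.
Qed.

(** The map u |-> u / (1 - u) sends the circle of radius r = |u| to the circle
    of centre r^2 / (1 - r^2) and radius r / (1 - r^2).  The centre depends on
    r only, not on the argument of u: this is what allows one value of t in
    [geometric_split] to serve both q z and q / z. *)
Lemma norm_mobius (C : numClosedFieldType) (u : C) : `|u| < 1 ->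
  `|u / (1 - u) - `|u| ^+ 2 / (1 - `|u| ^+ 2)| = `|u| / (1 - `|u| ^+ 2).
Proof.
move=> u1.
have r1 : 0 < 1 - `|u| ^+ 2 by rewrite subr_gt0 expr_lt1.
have hu : 1 - u != 0.
  by rewrite subr_eq0; apply: contraTneq u1 => <-; rewrite normr1 ltxx.
have hu' : 1 - u^* != 0 by rewrite -(rmorph1 Num.conj) -rmorphB/= fmorph_eq0.
have nr : 1 - `|u| ^+ 2 != 0 by rewrite gt_eqF.
have -> : u / (1 - u) - `|u| ^+ 2 / (1 - `|u| ^+ 2) =
   u * (1 - u^*) / ((1 - u) * (1 - `|u| ^+ 2)).
  rewrite mulrBr mulr1 -normCK; move: nr; set s := `|u| ^+ 2 => nr.
  by field; rewrite hu nr.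
rewrite !normrM !normfV !normrM (gtr0_norm r1).
rewrite (_ : `|1 - u^* | = `|1 - u|); last first.
  by rewrite -(norm_conjC (1 - u)) rmorphB rmorph1.
by field; rewrite normr_eq0 hu nr.
Qed.

(** Each of the two bracketed terms of the remainder in [geometric_split],
    recentred by t = - r^2 / (1 - r^2), has modulus exactly r / (1 - r^2).
    Plain truncation (t = 0) would give r / (1 - r), too large by the factor
    1 + r. *)
Lemma near_best_approx (C : numClosedFieldType) (q : C) (d : nat) : `|q| < 1 ->
  exists2 p : {poly C}, (size p <= d.+1)%N &
    forall z, `|z| = 1 ->
    `|(2 * q) / ((1 - q * z) * (1 - q * z^-1)) - p.[(z + z^-1) / 2]|
      <= 4 * (`|q| / (1 - `|q| ^+ 2)) ^+ 2 * `|q| ^+ d.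
Proof.
move=> q1.
have r1 : 0 < 1 - `|q| ^+ 2 by rewrite subr_gt0 expr_lt1.
have q21 : q ^+ 2 != 1.
  by apply: contraTneq r1 => h; rewrite -normrX h normr1 subrr ltxx.
have [p sp hp] := geometric_split (- (`|q| ^+ 2 / (1 - `|q| ^+ 2))) d q21.
exists p => // z z1.
have nz u : `|u| < 1 -> 1 - u != 0.
  by move=> u1; rewrite subr_eq0; apply: contraTneq u1 => <-; rewrite normr1 ltxx.
have z0 : z != 0 by rewrite -normr_eq0 z1 oner_eq0.
have qz : `|q * z| = `|q| by rewrite normrM z1 mulr1.
have qzV : `|q * z^-1| = `|q| by rewrite normrM normfV z1 invr1 mulr1.
rewrite hp ?nz ?qz ?qzV// addrAC subrr add0r.
rewrite !normrM !normfV normrX.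
rewrite (_ : 4 * _ * _ = (2 * `|q| / (1 - `|q| ^+ 2) * `|q| ^+ d) *
  (2 * (`|q| / (1 - `|q| ^+ 2)))); last by field; rewrite gt_eqF.
rewrite normr_nat ler_pM ?normr_ge0 ?mulr_ge0 ?exprn_ge0 ?invr_ge0//.
  rewrite ler_wpM2r ?exprn_ge0// ler_wpM2l ?mulr_ge0// lef_pV2 ?posrE//; last first.
    by rewrite normr_gt0 subr_eq0 eq_sym.
  by rewrite (le_trans _ (lerB_dist _ _))// normr1 normrX.
rewrite (le_trans (ler_normD _ _))// !normrM !normrX normfV z1 invr1 !expr1n !mul1r.
have := @norm_mobius C (q * z); rewrite qz => /(_ q1) ->.
have := @norm_mobius C (q * z^-1); rewrite qzV => /(_ q1) ->.
by rewrite mulr_natl mulr2n.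
Qed.

(** The two preimages of c under q |-> (q + 1/q) / 2 are inverse to each other,
    so one of them lies in the closed unit disc.  The last identity says that c
    lies on the ellipse with foci 1 and -1 whose sum of focal distances is
    r + 1/r, where r = |q|. *)
Lemma joukowski_inverse (C : numClosedFieldType) (c : C) :
  exists q : C, [/\ q != 0, q + q^-1 = 2 * c, `|q| <= 1 &
    `|c - 1| + `|c + 1| = `|q| + `|q|^-1].
Proof.
suff [q [q0 qc q1]] : exists q : C, [/\ q != 0, q + q^-1 = 2 * c & `|q| <= 1].
  exists q; split=> //.
  have -> : c = (q + q^-1) / 2 by rewrite qc mulrAC divff ?mul1r// pnatr_eq0.
  have -> : (q + q^-1) / 2 - 1 = (1 - q) ^+ 2 / (2 * q) by field.
  have -> : (q + q^-1) / 2 + 1 = (1 + q) ^+ 2 / (2 * q) by field.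
  rewrite !normrM !normfV !normrM normr_nat -!expr2 -mulrDl.
  rewrite (_ : _ + _ = 2 + 2 * `|q| ^+ 2).
    by field; rewrite normr_eq0.
  by rewrite !normCK rmorphB rmorphD rmorph1/=; ring.
pose s := sqrtC (c ^+ 2 - 1).
have hs : (c + s) * (c - s) = 1 by rewrite mulrC -subr_sqr sqrtCK; ring.
have : (`|c + s| <= 1) || (`|c - s| <= 1).
  have [//|] := boolP (`|c + s| <= 1).
  rewrite real_leNgt ?normr_real ?real1// negbK => h /=.
  rewrite -(ler_pM2l (lt_trans ltr01 h)) -normrM hs normr1 mulr1.
  exact: ltW.
have a0 : c + s != 0 by apply: contra_eq_neq hs => ->; rewrite mul0r eq_sym oner_eq0.
have b0 : c - s != 0 by apply: contra_eq_neq hs => ->; rewrite mulr0 eq_sym oner_eq0.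
case/orP => h; [exists (c + s)|exists (c - s)]; split => //.
  by rewrite (_ : (c + s)^-1 = c - s); [ring|rewrite -(mulKf a0 (c - s)) hs mulr1].
by rewrite (_ : (c - s)^-1 = c + s); [ring|rewrite -(mulfK b0 (c + s)) hs mul1r].
Qed.

(** * Approximation of 1 / (x + iw) on an interval *)

Section resolvent_approximation.
Context {R : rcfType}.
Local Open Scope complex_scope.
Local Notation normc := ComplexField.Normc.normc.

Lemma norm_normc (z : R[i]) : `|z| = (normc z)%:C.
Proof. by []. Qed.

Definition bernstein_alpha (a b w : R) : R :=
  (normc (a +i* w) + normc (b +i* w)) / (b - a).

(** With al = [bernstein_alpha a b w], this is the sum of the semi-axes of the
    ellipse with foci 1 and -1 through the pole c of the rescaled function
    1 / (X - c): al is its semi-major axis, sqrt (al^2 - 1) its semi-minor one. *)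
Definition bernstein_radius (a b w : R) : R :=
  bernstein_alpha a b w + Num.sqrt (bernstein_alpha a b w ^+ 2 - 1).

(** Up to the factor 8 / (b - a), the error of approximation of 1 / (x + iw) on
    [a, b] by polynomials of degree d. *)
Definition decay_factor (a b : R) (d : nat) (w : R) : R :=
  bernstein_radius a b w ^+ 2 / (bernstein_radius a b w ^+ 2 - 1) ^+ 2
    * (1 / bernstein_radius a b w) ^+ d.

Lemma decay_factorN (a b : R) (d : nat) (w : R) :
  decay_factor a b d (- w) = decay_factor a b d w.
Proof. by rewrite /decay_factor /bernstein_radius /bernstein_alpha /= sqrrN. Qed.

Lemma bernstein_alpha_gt1 (a b w : R) : 0 < a -> a < b -> 1 < bernstein_alpha a b w.
Proof.
move=> a0 ab; rewrite /bernstein_alpha ltr_pdivlMr ?subr_gt0// mul1r.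
have h (x : R) : 0 < x -> x <= normc (x +i* w).
  by move=> x0; rewrite /= -[leLHS]gtr0_norm// -sqrtr_sqr ler_wsqrtr// lerDl sqr_ge0.
have := h _ a0; have := h _ (lt_trans a0 ab).
lra.
Qed.

(** The function 1 / (x + iw) is, up to an affine change of variable, 1 / (X - c)
    on [-1, 1] with c on the ellipse of parameter 1/r = [bernstein_radius a b w];
    the approximation of [near_best_approx] is transported back.  The constant
    is 2 / (b - a), the Jacobian, times the 4 of that lemma. *)
Lemma resolvent_approx (a b w : R) (d : nat) : 0 < a -> a < b ->
  exists2 p : {poly R[i]}, (size p <= d.+1)%N &
    forall x : R, a <= x <= b ->
    normc ((x +i* w)^-1 - p.[x%:C]) <= 8 / (b - a) * decay_factor a b d w.
Proof.
move=> a0 ab; set rho := bernstein_radius a b w.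
have ba : 0 < b - a by rewrite subr_gt0.
(* The affine map x |-> X of [a, b] onto [-1, 1] turns x + iw into
   (b - a) / 2 * (X - c). *)
pose c : R[i] := ((- (a + b) / (b - a)) +i* (- (2 * w) / (b - a))).
have [q [q0 qc q1 qn]] := joukowski_inverse c.
set r := normc q.
have r0 : 0 < r by rewrite -ltcR -norm_normc normr_gt0.
have alE : bernstein_alpha a b w = (r + r^-1) / 2.
  have n2 : normc (- (2 / (b - a))%:C) = 2 / (b - a).
    by rewrite /= sqrrN oppr0 expr0n addr0 sqrtr_sqr gtr0_norm ?divr_gt0.
  have c1 : c - 1 = - (2 / (b - a))%:C * (b +i* w).
    by apply/eqP; rewrite eq_complex /=; apply/andP; split; apply/eqP;
      field; rewrite gt_eqF.
  have c2 : c + 1 = - (2 / (b - a))%:C * (a +i* w).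
    by apply/eqP; rewrite eq_complex /=; apply/andP; split; apply/eqP;
      field; rewrite gt_eqF.
  move: qn; rewrite c1 c2 !norm_normc -fmorphV -!rmorphD => /complexI.
  rewrite !Normc.normcM n2 => <-; rewrite /bernstein_alpha; field.
  by rewrite gt_eqF.
have r1 : r < 1.
  rewrite lt_neqAle -lecR -norm_normc q1 andbT; apply/eqP => r1.
  have := bernstein_alpha_gt1 w a0 ab; rewrite alE r1 invr1.
  by rewrite -mulr2n -mulr_natr mul1r divff ?pnatr_eq0// ltxx.
have rhoE : rho = r^-1.
  rewrite /rho /bernstein_radius alE.
  rewrite (_ : _ - 1 = ((r^-1 - r) / 2) ^+ 2); last by field; rewrite gt_eqF.
  rewrite sqrtr_sqr ger0_norm; first by field; rewrite gt_eqF.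
  by rewrite divr_ge0// subr_ge0 (le_trans (ltW r1))// invf_ge1 ?ltW.
have [|p sp hp] := @near_best_approx _ q d; first by rewrite norm_normc ltcR.
pose k := 2 / (b - a); have k0 : 0 < k by rewrite divr_gt0.
exists ((- k%:C) *: (p \Po (k%:C *: 'X - ((a + b) / (b - a))%:C%:P))).
  rewrite (leq_trans (size_scale_leq _ _))// (leq_trans (size_comp_poly_leq _ _))// ltnS.
  have: (size (k%:C *: 'X - ((a + b) / (b - a))%:C%:P)%R <= 2)%N.
    rewrite (leq_trans (size_polyD _ _))// geq_max size_polyN.
    rewrite (leq_trans (size_scale_leq _ _)) ?size_polyX//.
    by rewrite (leq_trans (size_polyC_leq1 _)).
  case: (size _) => [|[|[|//]]] _; rewrite ?muln0// muln1.
  by move: sp; case: (size p).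
move=> x /andP[ax xb].
pose X := k * x - (a + b) / (b - a).
have XE : X = ((x - a) - (b - x)) / (b - a) by rewrite /X /k; field; rewrite gt_eqF.
have X1 : X ^+ 2 <= 1.
  rewrite XE expr_div_n ler_pdivrMr ?exprn_gt0// mul1r.
  nra.
(* The point of the unit circle above X, so that X = (z + 1/z) / 2. *)
pose z : R[i] := X +i* Num.sqrt (1 - X ^+ 2).
have s2 : Num.sqrt (1 - X ^+ 2) ^+ 2 = 1 - X ^+ 2 by rewrite sqr_sqrtr ?subr_ge0.
have z1 : `|z| = 1.
  by rewrite norm_normc /= s2 addrC subrK sqrtr1.
have zV : z^-1 = X -i* Num.sqrt (1 - X ^+ 2).
  rewrite -[LHS]mulr1 -(expr1n _ 2%N) -z1 normCK mulKf//.
  by rewrite -normr_eq0 z1 oner_eq0.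
have zX : (z + z^-1) / 2 = X%:C.
  rewrite zV; apply: (canLR (mulfK _)); first by rewrite pnatr_eq0.
  apply/eqP; rewrite eq_complex /=; apply/andP; split; apply/eqP; ring.
have cX : 2 * q / ((1 - q * z) * (1 - q * z^-1)) = (c - X%:C)^-1.
  have -> : (1 - q * z) * (1 - q * z^-1) = 2 * q * (c - X%:C).
    rewrite [RHS]mulrBr [2 * q]mulrC -[q * 2 * c]mulrA -qc -zX; field.
    by rewrite q0 -normr_eq0 z1 oner_eq0.
  by rewrite invfM mulrA divff ?mul1r// mulf_neq0// pnatr_eq0.
have cxE : x +i* w = - k^-1%:C * (c - X%:C).
  by apply/eqP; rewrite eq_complex /=; apply/andP; split; apply/eqP;
    rewrite /X /k; field; rewrite gt_eqF.
have := hp _ z1.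
rewrite cX zX !norm_normc => h.
rewrite hornerZ horner_comp !(hornerD, hornerN, hornerZ, hornerX, hornerC).
rewrite -rmorphM -rmorphB -/X cxE invfM invrN.
rewrite -rmorphV/= ?unitfE ?invr_eq0 ?gt_eqF// invrK.
have -> : - k%:C / (c - X%:C) - - k%:C * p.[X%:C]
    = - k%:C * ((c - X%:C)^-1 - p.[X%:C]) by rewrite mulrBr.
have nk : normc (- k%:C) = k.
  by rewrite /= sqrrN oppr0 expr0n addr0 sqrtr_sqr gtr0_norm.
rewrite Normc.normcM nk.
have : normc ((c - X%:C)^-1 - p.[X%:C]) <= 4 * (r / (1 - r ^+ 2)) ^+ 2 * r ^+ d.
  rewrite -lecR (le_trans h)// !(rmorphM, rmorphXn, rmorphB, rmorph_nat, rmorph1).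
  by rewrite fmorphV !(rmorphM, rmorphXn, rmorphB, rmorph_nat, rmorph1).
rewrite -(ler_pM2l k0) => /le_trans; apply.
rewrite /decay_factor -/rho rhoE div1r invrK le_eqVlt; apply/orP; left; apply/eqP.
rewrite /k; field.
by rewrite mulN1r !gt_eqF ?subr_gt0 ?expr_lt1// ltW.
Qed.

End resolvent_approximation.

(** * Spectral decomposition of real symmetric matrices *)

Lemma mulmx_similar (A : pzRingType) n (V V' D E : 'M[A]_n) : V *m V' = 1%:M ->
  (V' *m D *m V) *m (V' *m E *m V) = V' *m (D *m E) *m V.
Proof. by move=> VV; rewrite !mulmxA -(mulmxA _ V V') VV mulmx1. Qed.

Lemma right_inverse_invmx (A : comUnitRingType) n (S N : 'M[A]_n) :
  S *m N = 1%:M -> N = invmx S.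
Proof.
move=> NS; have [uS _] := mulmx1_unit NS.
by rewrite -[RHS]mulmx1 -NS mulKmx.
Qed.

Section spectral_decomposition.
Context {R : realType}.
Local Open Scope complex_scope.
Local Notation cmx := (map_mx (real_complex R)).

Definition realdiag n (L : 'I_n -> R) : 'M[R[i]]_n := diag_mx (\row_p (L p)%:C).

Definition adjointmx m n (U : 'M[R[i]]_(m, n)) := map_mx Num.conj U^T.

(** The columns of [adjointmx U] are an orthonormal basis of complex eigenvectors
    of the real matrix [M], with real eigenvalues [L]; each eigenvalue occurs in
    [L] with its multiplicity. *)
Record spectral_data n (M : 'M[R]_n) (U : 'M[R[i]]_n) (L : 'I_n -> R) : Prop :=
  SpectralData {
    spectral_unitary : U *m adjointmx U = 1%:M;
    spectral_decomp : cmx M = adjointmx U *m realdiag L *m U }.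

Lemma symmetric_spectral_data n (M : 'M[R]_n) : M^T = M ->
  exists U L, spectral_data M U L.
Proof.
move=> symM.
have herm : cmx M \is hermitianmx _ false Num.conj.
  apply/is_hermitianmxP; rewrite expr0 scale1r; apply/matrixP => i j.
  by rewrite !mxE -{1}symM mxE; apply/esym/CrealP; apply/complex_realP; exists (M j i).
exists (spectralmx (cmx M)), (fun p => complex.Re (spectral_diag (cmx M) 0 p)).
have uU := spectral_unitarymx (cmx M).
have adjE : adjointmx (spectralmx (cmx M)) = invmx (spectralmx (cmx M)).
  by rewrite invmx_unitary// /adjointmx map_trmx.
split; first by rewrite adjE mulmxV// spectral_unit.
have /orthomx_spectralP {1}-> := hermitian_normalmx herm.
rewrite adjE /realdiag.
suff -> : \row_p (complex.Re (spectral_diag (cmx M) 0 p))%:C = spectral_diag (cmx M).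
  by [].
apply/rowP => p; rewrite mxE RRe_real//.
by have /mxOverP := hermitian_spectral_diag_real herm; apply.
Qed.

Section with_spectral_data.
Context (n : nat) (M : 'M[R]_n) (U : 'M[R[i]]_n) (L : 'I_n -> R).
Context (sdM : spectral_data M U L).

Lemma spectral_unitaryV : adjointmx U *m U = 1%:M.
Proof. exact/mulmx1C/(spectral_unitary sdM). Qed.

Lemma realdiag_mull m (A : 'M[R[i]]_(n, m)) p j :
  (realdiag L *m A) p j = (L p)%:C * A p j.
Proof. by rewrite mul_diag_mx !mxE. Qed.

Lemma spectral_eigenvalueP a : eigenvalue M a <-> exists p, a = L p.
Proof.
rewrite -(eigenvalue_map (real_complex R)) (spectral_decomp sdM).
have uU := spectral_unitary sdM; have uV := spectral_unitaryV.
split.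
  move=> /eigenvalueP[v hv v0].
  pose u := v *m adjointmx U.
  have hu : u *m realdiag L = a%:C *: u.
    by rewrite /u scalemxAl -hv -!mulmxA uU mulmx1.
  have u0 : u != 0.
    by apply: contraNneq v0 => u0; rewrite -[v]mulmx1 -uV mulmxA -/u u0 mul0mx.
  clearbody u; have /rV0Pn[p up] := u0; exists p.
  move/rowP/(_ p): hu; rewrite mul_mx_diag !mxE mulrC => /(mulIf up) h.
  exact/esym/complexI.
move=> [p ->]; apply/eigenvalueP; exists (row p U).
  rewrite -row_mul !mulmxA uU mul1mx.
  by apply/rowP => j; rewrite mxE realdiag_mull !mxE.
apply/eqP => /rowP h.
have /eqP : (U *m adjointmx U) p p = 1 by rewrite uU mxE eqxx.
rewrite mxE big1 1?eq_sym ?oner_eq0// => j _.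
by have := h j; rewrite !mxE => ->; rewrite mul0r.
Qed.

Lemma spectral_pos p : posdefmx M -> 0 < L p.
Proof.
move=> pdM; have /eigenvalueP[v hv v0] : eigenvalue M (L p).
  by apply/spectral_eigenvalueP; exists p.
have vT0 : v^T != 0 by rewrite trmx_eq0.
have := pdM _ vT0; rewrite trmxK hv -scalemxAl mxE.
have vv : 0 <= (v *m v^T) 0 0.
  by rewrite mxE sumr_ge0// => i _; rewrite mxE -expr2 sqr_ge0.
by move=> h; rewrite ltNge; apply: contraTN h => Lp; rewrite -leNgt mulr_le0_ge0.
Qed.

Lemma lambda_min_le p : posdefmx M -> lambda_min M <= L p.
Proof.
move=> pdM; apply: ge_inf; last by apply/spectral_eigenvalueP; exists p.
exists 0 => _ /spectral_eigenvalueP[q ->]; exact/ltW/spectral_pos.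
Qed.

Lemma le_lambda_max p : L p <= lambda_max M.
Proof.
apply: ub_le_sup; last by apply/spectral_eigenvalueP; exists p.
exists (\sum_q `|L q|) => _ /spectral_eigenvalueP[q ->].
by rewrite (le_trans (ler_norm _))// (bigD1 q)//= lerDl sumr_ge0.
Qed.

(** Strictness holds because the infimum is attained, the spectrum being finite. *)
Lemma lambda_min_gt0 : (0 < n)%N -> posdefmx M -> 0 < lambda_min M.
Proof.
move=> n0 pdM; pose p0 := [arg min_(p < Ordinal n0) L p]%O.
apply: (@lt_le_trans _ _ (L p0)); first exact: spectral_pos.
apply: lb_le_inf; first by exists (L p0); apply/spectral_eigenvalueP; exists p0.
move=> _ /spectral_eigenvalueP[q ->]; rewrite /p0.
by case: arg_minP => // p _ /(_ q isT).
Qed.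

Lemma lambda_min_lt_max : (0 < n)%N -> posdefmx M -> lambda_max M <> lambda_min M ->
  lambda_min M < lambda_max M.
Proof.
move=> n0 pdM ne; rewrite lt_neqAle; apply/andP; split.
  by rewrite eq_sym; apply/eqP.
exact: le_trans (lambda_min_le (Ordinal n0) pdM) (le_lambda_max _).
Qed.

(** If f is any function on the spectrum, the entry (i, j) of f(M) is
    \sum_p spectral_weight i j p * f (L p). *)
Definition spectral_weight (i j p : 'I_n) : R[i] := Num.conj (U p i) * U p j.

(** Two columns of a unitary matrix are unit vectors; the bound follows from
    x y <= (x^2 + y^2) / 2. *)
Lemma spectral_weight_norm i j : \sum_p `|spectral_weight i j p| <= 1.
Proof.
have h k : \sum_p `|U p k| ^+ 2 = 1.
  have : (adjointmx U *m U) k k = 1 by rewrite spectral_unitaryV mxE eqxx.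
  rewrite mxE => h1; rewrite -[RHS]h1; apply: eq_bigr => p _.
  by rewrite !mxE normCK mulrC.
apply: (@le_trans _ _ (\sum_p (`|U p i| ^+ 2 + `|U p j| ^+ 2) / 2)); last first.
  by rewrite -mulr_suml big_split/= !h divff.
apply: ler_sum => p _; rewrite normrM norm_conjC.
rewrite ler_pdivlMr// -subr_ge0.
rewrite (_ : _ - _ = (`|U p i| - `|U p j|) ^+ 2); last by ring.
by rewrite -realEsqr rpredB// normr_real.
Qed.

(** The sum is the entry (i, j) of M ^ k, and the k-th power of a tridiagonal
    matrix has bandwidth k. *)
Lemma spectral_weight_band (k : nat) (i j : 'I_n) : tridiagonal M -> (k < `|i - j|)%N ->
  \sum_p spectral_weight i j p * (L p)%:C ^+ k = 0.
Proof.
move=> triM.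
pose E k := adjointmx U *m realdiag (fun p => L p ^+ k) *m U.
have EE l i' : \sum_p spectral_weight i' j p * (L p)%:C ^+ l = E l i' j.
  rewrite mxE; apply: eq_bigr => p _.
  by rewrite mul_mx_diag !mxE rmorphXn mulrAC.
rewrite EE; elim: k i => [|k IHk] i; rewrite {EE}.
  rewrite /E (_ : realdiag _ = 1%:M) ?mulmx1 ?spectral_unitaryV; last first.
    rewrite /realdiag -diag_const_mx; congr diag_mx.
    by apply/rowP => q; rewrite !mxE expr0.
  by rewrite mxE; case: eqP => // ->; rewrite distnn.
have -> : E k.+1 = cmx M *m E k.
  rewrite (spectral_decomp sdM) /E (mulmx_similar _ _ (spectral_unitary sdM)).
  suff -> : realdiag (fun p => L p ^+ k.+1) = realdiag L *m realdiag (fun p => L p ^+ k).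
    by [].
  apply/matrixP => p q; rewrite realdiag_mull !mxE.
  by case: eqP => _; rewrite ?mulr0// exprS rmorphM.
move=> ki; rewrite mxE big1// => l _.
have [il|il] := ltnP 1 `|i - l|; first by rewrite mxE triM// mul0r.
rewrite IHk ?mulr0//; move: ki il; lia.
Qed.

Lemma spectral_weight_poly (i j : 'I_n) (P : {poly R[i]}) : tridiagonal M ->
  (size P <= `|i - j|)%N -> \sum_p spectral_weight i j p * P.[(L p)%:C] = 0.
Proof.
move=> triM sP.
under eq_bigr => p _ do rewrite horner_coef mulr_sumr.
rewrite exchange_big big1//= => k _.
under eq_bigr => p _ do rewrite mulrCA.
by rewrite -mulr_sumr spectral_weight_band ?mulr0// (leq_trans (ltn_ord k)).
Qed.

End with_spectral_data.
End spectral_decomposition.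

(** * Entries of resolvents and of inverses of Kronecker sums *)

Section resolvent_entries.
Context {R : realType}.
Local Open Scope complex_scope.
Local Notation cmx := (map_mx (real_complex R)).

Lemma RfunE n (M : 'M[R]_n) w : lambda_min M <= lambda_max M ->
  Rfun M w = bernstein_radius (lambda_min M) (lambda_max M) w.
Proof.
move=> le_mM; rewrite /Rfun.
suff -> : alpha M w = bernstein_alpha (lambda_min M) (lambda_max M) w by [].
rewrite /alpha /lambda1 /lambda2; congr (_ / _).
by rewrite /= subrr expr0n addr0 sqrtr_sqr ger0_norm ?subr_ge0.
Qed.

Section resolvent_entry.
Context (n : nat) (M : 'M[R]_n) (U : 'M[R[i]]_n) (L : 'I_n -> R).
Context (sdM : spectral_data M U L).

(** The entry (i, j) of the inverse of M + iw. *)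
Definition resolvent_entry (i j : 'I_n) (w : R) : R[i] :=
  \sum_p spectral_weight U i j p * (L p +i* w)^-1.

(** A polynomial in M of degree less than |i - j| has a zero entry (i, j), so the
    entry of the resolvent equals that of the resolvent minus the polynomial
    of [resolvent_approx], whose values on the spectrum are small. *)
Lemma resolvent_entry_le (i j : 'I_n) (w : R) :
  posdefmx M -> tridiagonal M -> lambda_max M <> lambda_min M -> i != j ->
  `|resolvent_entry i j w| <=
    (8 / (lambda_max M - lambda_min M)
       * decay_factor (lambda_min M) (lambda_max M) (`|i - j| - 1)%N w)%:C.
Proof.
move=> pdM triM neM ij.
have n0 : (0 < n)%N by exact: leq_trans (ltn_ord i).
have mgt0 := lambda_min_gt0 sdM n0 pdM.
have ltmM := lambda_min_lt_max sdM n0 pdM neM.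
have [p sp hp] := resolvent_approx w (`|i - j| - 1) mgt0 ltmM.
set B := _ * decay_factor _ _ _ _ in hp *.
have -> : resolvent_entry i j w =
    \sum_q spectral_weight U i j q * ((L q +i* w)^-1 - p.[(L q)%:C]).
  under [RHS]eq_bigr => q _ do rewrite mulrBr.
  rewrite sumrB (spectral_weight_poly sdM) ?subr0// (leq_trans sp)//.
  have : (i : nat) <> j by move=> h; move/eqP: ij; apply; exact/val_inj.
  lia.
have hq q : `|(L q +i* w)^-1 - p.[(L q)%:C]| <= B%:C.
  rewrite norm_normc lecR; apply: hp.
  by rewrite (lambda_min_le sdM) ?(le_lambda_max sdM).
rewrite (le_trans (ler_norm_sum _ _ _))//.
apply: (@le_trans _ _ (\sum_q `|spectral_weight U i j q| * B%:C)).
  by apply: ler_sum => q _; rewrite normrM ler_wpM2l.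
rewrite -mulr_suml -[leRHS]mul1r ler_wpM2r ?(spectral_weight_norm sdM)//.
by rewrite (le_trans _ (hq (Ordinal n0))).
Qed.

End resolvent_entry.

Section kronecker.
Context (n1 n2 : nat) (M1 : 'M[R]_n1) (M2 : 'M[R]_n2).
Context (U1 : 'M[R[i]]_n1) (U2 : 'M[R[i]]_n2) (L1 : 'I_n1 -> R) (L2 : 'I_n2 -> R).
Context (sd1 : spectral_data M1 U1 L1) (sd2 : spectral_data M2 U2 L2).
Context (pd1 : posdefmx M1) (pd2 : posdefmx M2).

Lemma map_tensmx (A : 'M[R]_n1) (B : 'M[R]_n2) : cmx (A *t B) = cmx A *t cmx B.
Proof. by apply/matrixP => i j; rewrite !mxE rmorphM. Qed.

Lemma tens_id_mx : (1%:M : 'M[R[i]]_n1) *t (1%:M : 'M[R[i]]_n2) = 1%:M.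
Proof.
apply/matrixP => s t; case: (mxtens_indexP s) => i j; case: (mxtens_indexP t) => i' j'.
rewrite tensmxE !mxE (can_eq (@mxtens_indexK n1 n2)) xpair_eqE.
by case: eqP; case: eqP; rewrite ?mulr0 ?mul0r ?mulr1.
Qed.

(** The Kronecker product of the two eigenbases diagonalises the Kronecker sum,
    with the pairwise sums of eigenvalues on the diagonal. *)
Lemma kronsum_inv_entry (k t : 'I_(n1 * n2)) :
  (invmx (kronsum M1 M2) k t)%:C =
  \sum_p \sum_q
    spectral_weight U1 (mxtens_unindex k).1 (mxtens_unindex t).1 p
    * spectral_weight U2 (mxtens_unindex k).2 (mxtens_unindex t).2 q
    * ((L1 p + L2 q)^-1)%:C.
Proof.
pose V := U1 *t U2; pose V' := adjointmx U1 *t adjointmx U2.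
pose e (s : 'I_(n1 * n2)) := L1 (mxtens_unindex s).1 + L2 (mxtens_unindex s).2.
have e0 s : e s != 0.
  by rewrite gt_eqF// addr_gt0// ?(spectral_pos sd1)// (spectral_pos sd2).
have VV : V *m V' = 1%:M.
  by rewrite tensmx_mul (spectral_unitary sd1) (spectral_unitary sd2) tens_id_mx.
have VV' : V' *m V = 1%:M.
  by rewrite tensmx_mul (spectral_unitaryV sd1) (spectral_unitaryV sd2) tens_id_mx.
have SE : cmx (kronsum M1 M2) = V' *m realdiag e *m V.
  rewrite map_mxD.
  have -> : cmx (M1 *t 1%:M) = V' *m (realdiag L1 *t 1%:M) *m V.
    rewrite !tensmx_mul mulmx1 (spectral_unitaryV sd2) -(spectral_decomp sd1).
    by rewrite map_tensmx map_scalar_mx rmorph1.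
  have -> : cmx (1%:M *t M2) = V' *m (1%:M *t realdiag L2) *m V.
    rewrite !tensmx_mul mulmx1 (spectral_unitaryV sd1) -(spectral_decomp sd2).
    by rewrite map_tensmx map_scalar_mx rmorph1.
  rewrite -mulmxDl -mulmxDr.
  suff -> : realdiag L1 *t 1%:M + 1%:M *t realdiag L2 = realdiag e by [].
  apply/matrixP => s r; case: (mxtens_indexP s) => i j; case: (mxtens_indexP r) => i' j'.
  rewrite mxE !tensmxE !mxE (can_eq (@mxtens_indexK n1 n2)) xpair_eqE /e !mxtens_indexK/=.
  by case: eqP; case: eqP; rewrite ?mulr0 ?mul0r ?mulr1 ?mul1r ?addr0 ?add0r// rmorphD.
have -> : (invmx (kronsum M1 M2) k t)%:C = (V' *m realdiag (fun s => (e s)^-1) *m V) k t.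
  have -> : V' *m realdiag (fun s => (e s)^-1) *m V = invmx (cmx (kronsum M1 M2)).
    suff NS : cmx (kronsum M1 M2) *m (V' *m realdiag (fun s => (e s)^-1) *m V) = 1%:M.
      exact: right_inverse_invmx NS.
    rewrite SE (mulmx_similar _ _ VV).
    suff -> : realdiag e *m realdiag (fun s => (e s)^-1) = 1%:M by rewrite mulmx1.
    apply/matrixP => s r; rewrite realdiag_mull !mxE.
    by case: eqP => [->|_]; rewrite ?mulr0// mulr1n -rmorphM mulfV.
  by rewrite -map_invmx mxE.
rewrite mxE pair_big/=.
rewrite (reindex_onto (@mxtens_unindex n1 n2) (@mxtens_index n1 n2))/=; last first.
  by move=> s _; rewrite mxtens_indexK.
apply: eq_big => [s|s _]; first by rewrite mxtens_unindexK eqxx.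
rewrite mul_mx_diag !mxE /spectral_weight /e.
by rewrite mulrAC mulrACA.
Qed.

End kronecker.
End resolvent_entries.

(** * The integral of 1 / ((l + iw) (m - iw)) *)

Lemma Rintegral_lincomb (R : realType) (d : measure_display) (T : measurableType d)
    (mu : {measure set T -> \bar R}) (I : finType) (c : I -> R) (h : I -> T -> R) :
  (forall i, mu.-integrable [set: T] (EFin \o h i)) ->
  mu.-integrable [set: T] (EFin \o (fun w => \sum_i c i * h i w)) /\
  \int[mu]_w (\sum_i c i * h i w) = \sum_i c i * \int[mu]_w h i w.
Proof.
move=> ih.
suff H (s : seq I) :
    mu.-integrable [set: T] (EFin \o (fun w => \sum_(i <- s) c i * h i w)) /\
    \int[mu]_w (\sum_(i <- s) c i * h i w) = \sum_(i <- s) c i * \int[mu]_w h i w.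
  exact: H.
elim: s => [|i s [IHi IHs]].
  split.
    have := integrable0 mu [set: T].
    by apply: eq_integrable => // w _ /=; rewrite big_nil.
  by under eq_Rintegral => w _ do rewrite big_nil; rewrite big_nil Rintegral_cst// mul0r.
have ich : mu.-integrable [set: T] (EFin \o (fun w => c i * h i w)).
  exact: (integrableZl measurableT (c i) (ih i)).
split.
  have := integrableD measurableT ich IHi.
  by apply: eq_integrable => // w _ /=; rewrite big_cons.
under eq_Rintegral => w _ do rewrite big_cons.
by rewrite big_cons RintegralD// IHs RintegralZl.
Qed.

Section integrals.
Context {R : realType}.
Local Open Scope classical_set_scope.
Local Open Scope complex_scope.
Local Notation mu := (@lebesgue_measure R).

Definition cauchy_kernel (l w : R) : R := l / (l ^+ 2 + w ^+ 2).

Lemma cauchy_kernel_den_gt0 (l w : R) : 0 < l -> 0 < l ^+ 2 + w ^+ 2.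
Proof. by move=> l0; rewrite ltr_pwDl ?exprn_gt0 ?sqr_ge0. Qed.

Lemma continuous_cauchy_kernel (l : R) : 0 < l -> continuous (cauchy_kernel l).
Proof.
move=> l0 w; apply: cvgM; first exact: cvg_cst.
apply: cvgV; first by rewrite gt_eqF// cauchy_kernel_den_gt0.
by apply: cvgD; [exact: cvg_cst|exact: exprn_continuous].
Qed.

Lemma cauchy_kernel_ge0 (l w : R) : 0 < l -> 0 <= cauchy_kernel l w.
Proof. by move=> l0; rewrite divr_ge0// ltW// cauchy_kernel_den_gt0. Qed.

Lemma integral_cauchy_kernel (l : R) : 0 < l ->
  (\int[mu]_w (cauchy_kernel l w)%:E = pi%:E)%E.
Proof.
move=> l0.
have dF (x : R) : is_derive x (1 : R) (fun w => atan (w / l)) (cauchy_kernel l x).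
  have h : is_derive x (1 : R) (fun w : R => w / l) l^-1.
    rewrite (_ : (fun w => w / l) = l^-1 \*: (id : R -> R)); last first.
      by apply/funext => w /=; rewrite mulrC.
    by apply: is_derive_eq; rewrite /GRing.scale /= mulr1.
  have := @is_derive1_comp R atan (fun w => w / l) x _ _ (is_derive1_atan (x / l)) h.
  rewrite (_ : _ * l^-1 = cauchy_kernel l x)// /cauchy_kernel; field.
  by rewrite !gt_eqF// ?cauchy_kernel_den_gt0// addr_gt0 ?exprn_gt0.
rewrite ge0_symfun_integralT//; last 3 first.
- by move=> x; exact: cauchy_kernel_ge0.
- exact: continuous_cauchy_kernel.
- by move=> x; rewrite /cauchy_kernel /= sqrrN.
have -> : [set x : R | 0 <= x] = `[0, +oo[.
  by apply/seteqP; split => x; rewrite /= in_itv/= andbT.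
rewrite (@ge0_continuous_FTC2y _ _ (fun w => atan (w / l)) 0 (pi / 2)).
- rewrite mul0r atan0 sube0 -EFinM; congr (_%:E); by field.
- by move=> x _; exact: cauchy_kernel_ge0.
- by apply: continuous_subspaceT; exact: continuous_cauchy_kernel.
- apply: (cvg_comp _ _ _ (@cvgy_atan R)).
  by apply: gt0_cvgMly; [rewrite invr_gt0|exact: cvg_id].
- by move=> x _; exact: ex_derive.
- apply: cvg_at_right_filter.
  apply: differentiable_continuous; apply/derivable1_diffP; exact: ex_derive.
- by move=> x _; rewrite derive1E; exact: derive_val.
Qed.

Lemma integrable_cauchy_kernel (l : R) : 0 < l ->
  mu.-integrable [set: R] (EFin \o cauchy_kernel l).
Proof.
move=> l0; apply/integrableP; split.
  apply/measurable_EFinP; apply: continuous_measurable_fun.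
  exact: continuous_cauchy_kernel.
under eq_integral => x _ do rewrite /= ger0_norm ?cauchy_kernel_ge0//.
by rewrite integral_cauchy_kernel// ltry.
Qed.

(** The real part of 1 / ((l + iw) (m - iw)); the imaginary part is odd in w and
    does not contribute to integrals over the line. *)
Definition tensor_kernel (l m w : R) : R :=
  (l * m + w ^+ 2) / ((l ^+ 2 + w ^+ 2) * (m ^+ 2 + w ^+ 2)).

(** Partial fractions: the kernel is a combination of two Cauchy densities. *)
Lemma tensor_kernelE (l m w : R) : 0 < l -> 0 < m ->
  tensor_kernel l m w = (l + m)^-1 * (cauchy_kernel l w + cauchy_kernel m w).
Proof.
move=> l0 m0; rewrite /tensor_kernel /cauchy_kernel; field.
by rewrite !gt_eqF ?cauchy_kernel_den_gt0 ?addr_gt0.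
Qed.

Lemma integrable_tensor_kernel (l m : R) : 0 < l -> 0 < m ->
  mu.-integrable [set: R] (EFin \o tensor_kernel l m).
Proof.
move=> l0 m0.
have il := integrable_cauchy_kernel l0; have im := integrable_cauchy_kernel m0.
have := integrableZl measurableT (l + m)^-1 (integrableD measurableT il im).
by apply: eq_integrable => // w _ /=; rewrite tensor_kernelE.
Qed.

Lemma integral_tensor_kernel (l m : R) : 0 < l -> 0 < m ->
  \int[mu]_w tensor_kernel l m w = 2 * pi / (l + m).
Proof.
move=> l0 m0.
under eq_Rintegral => w _ do rewrite tensor_kernelE//.
have il := integrable_cauchy_kernel l0; have im := integrable_cauchy_kernel m0.
rewrite RintegralZl//; last first.
  exact: (integrableD measurableT il im).
rewrite RintegralD// /Rintegral !integral_cauchy_kernel//=.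
move: (@pi R) => p; field.
by rewrite gt_eqF ?addr_gt0.
Qed.

Lemma tensor_kernelC (l m w : R) : 0 < l -> 0 < m ->
  (tensor_kernel l m w)%:C =
  ((l +i* w)^-1 * (m +i* (- w))^-1 + (l +i* (- w))^-1 * (m +i* w)^-1) / 2.
Proof.
move=> l0 m0; have l1 := cauchy_kernel_den_gt0 w l0.
have m1 := cauchy_kernel_den_gt0 w m0.
have iE (x y : R) :
  (x +i* y)^-1 = (x / (x ^+ 2 + y ^+ 2)) +i* (- (y / (x ^+ 2 + y ^+ 2))).
  by [].
have hh : 2^-1 = (2^-1 : R)%:C by rewrite fmorphV rmorph_nat.
rewrite hh !iE ?sqrrN//; apply/eqP; rewrite eq_complex /=.
by apply/andP; split; apply/eqP; rewrite /tensor_kernel; field; rewrite ?gt_eqF.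
Qed.

End integrals.

(** * Continuity and integrability of the decay factor *)

Section decay_factor.
Context {R : realType} (a b : R).
Context (a0 : 0 < a) (ab : a < b).
Local Open Scope complex_scope.

(** By Cauchy-Schwarz the product of the moduli of a + iw and b + iw is at least
    ab + w^2, so the square of their sum is at least (a + b)^2 + 4 w^2. *)
Lemma bernstein_alpha_ge (w : R) :
  4 * (a * b + w ^+ 2) / (b - a) ^+ 2 <= bernstein_alpha a b w ^+ 2 - 1.
Proof.
have ba : 0 < b - a by rewrite subr_gt0.
rewrite lerBrDr /bernstein_alpha expr_div_n.
rewrite -[X in _ + X](@divff _ ((b - a) ^+ 2)) ?expf_neq0 ?gt_eqF//.
rewrite -mulrDl ler_pM2r ?invr_gt0 ?exprn_gt0//.
have sq x : ComplexField.Normc.normc (x +i* w) ^+ 2 = x ^+ 2 + w ^+ 2.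
  by rewrite /= sqr_sqrtr ?addr_ge0 ?sqr_ge0.
have cs : a * b + w ^+ 2 <=
    ComplexField.Normc.normc (a +i* w) * ComplexField.Normc.normc (b +i* w).
  have p0 : 0 <= a * b + w ^+ 2.
    by rewrite addr_ge0 ?sqr_ge0 ?mulr_ge0// ltW// (lt_trans a0).
  rewrite -ler_sqr ?nnegrE//; last by rewrite mulr_ge0 ?sqrtr_ge0.
  rewrite exprMn !sq -subr_ge0.
  by rewrite (_ : _ - _ = ((b - a) * w) ^+ 2) ?sqr_ge0//; ring.
move: (sq a) (sq b) cs.
set x := ComplexField.Normc.normc (a +i* w); set y := ComplexField.Normc.normc _.
nra.
Qed.

Lemma bernstein_radius_gt1 (w : R) : 1 < bernstein_radius a b w.
Proof.
by rewrite (lt_le_trans (bernstein_alpha_gt1 w a0 ab))// lerDl sqrtr_ge0.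
Qed.

(** If rho = al + s with s^2 = al^2 - 1, then rho - 1/rho = 2 s. *)
Lemma bernstein_factorE (w : R) :
  bernstein_radius a b w ^+ 2 / (bernstein_radius a b w ^+ 2 - 1) ^+ 2
  = (4 * (bernstein_alpha a b w ^+ 2 - 1))^-1.
Proof.
have al1 := bernstein_alpha_gt1 w a0 ab; have r1 := bernstein_radius_gt1 w.
rewrite /bernstein_radius in r1 *.
set al := bernstein_alpha a b w in al1 r1 *; set s := Num.sqrt _ in r1 *.
have s0 : 0 < s by rewrite sqrtr_gt0 subr_gt0 expr_gt1// ltW// (lt_trans ltr01).
have ss : al ^+ 2 - 1 = s ^+ 2.
  by rewrite sqr_sqrtr// subr_ge0 ltW// expr_gt1// ltW// (lt_trans ltr01).
rewrite ss (_ : (al + s) ^+ 2 - 1 = 2 * s * (al + s)); last first.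
  by rewrite sqrrD -(subrK 1 (al ^+ 2)) ss; ring.
by field; rewrite !gt_eqF// (lt_trans ltr01).
Qed.

Lemma decay_factor_ge0 d w : 0 <= decay_factor a b d w.
Proof.
have r1 := bernstein_radius_gt1 w.
rewrite /decay_factor mulr_ge0 ?divr_ge0 ?sqr_ge0 ?exprn_ge0//.
by rewrite divr_ge0// ltW// (lt_trans ltr01).
Qed.

Lemma decay_factor_le d w :
  decay_factor a b d w <= (b - a) ^+ 2 / 16 / (a * b + w ^+ 2).
Proof.
have ba : 0 < b - a by rewrite subr_gt0.
have r1 := bernstein_radius_gt1 w; have r0 := lt_trans ltr01 r1.
have q0 : 0 < a * b + w ^+ 2.
  by rewrite ltr_pwDl ?sqr_ge0 ?mulr_gt0// (lt_trans a0).
apply: (@le_trans _ _ ((4 * (bernstein_alpha a b w ^+ 2 - 1))^-1)).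
  rewrite /decay_factor bernstein_factorE -[leRHS]mulr1 ler_wpM2l//.
    rewrite invr_ge0 mulr_ge0// (le_trans _ (bernstein_alpha_ge w))//.
    by rewrite divr_ge0 ?exprn_ge0 ?mulr_ge0 ?ltW.
  by rewrite exprn_ile1 ?mul1r ?invr_ge0 ?ltW// invf_lt1.
rewrite (_ : _ / _ / _ = (4 * (4 * (a * b + w ^+ 2) / (b - a) ^+ 2))^-1); last first.
  by field; rewrite !gt_eqF.
have p0 : 0 < 4 * (4 * (a * b + w ^+ 2) / (b - a) ^+ 2).
  by rewrite mulr_gt0// divr_gt0 ?mulr_gt0 ?exprn_gt0.
have h : 4 * (4 * (a * b + w ^+ 2) / (b - a) ^+ 2) <=
  4 * (bernstein_alpha a b w ^+ 2 - 1) by rewrite ler_pM2l// bernstein_alpha_ge.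
by rewrite lef_pV2 ?posrE// (lt_le_trans p0).
Qed.

Lemma continuous_normc_line (x : R) :
  continuous (fun w : R => ComplexField.Normc.normc (x +i* w)).
Proof.
change (continuous (@Num.sqrt R \o (fun w => x ^+ 2 + w ^+ 2))) => w.
apply: continuous_comp.
  by apply: cvgD; [exact: cvg_cst|exact: exprn_continuous].
exact: sqrt_continuous.
Qed.

Lemma continuous_bernstein_alpha : continuous (bernstein_alpha a b).
Proof.
move=> w; apply: cvgM; last exact: cvg_cst.
by apply: cvgD; exact: continuous_normc_line.
Qed.

Lemma continuous_bernstein_radius : continuous (bernstein_radius a b).
Proof.
move=> w; apply: cvgD; first exact: continuous_bernstein_alpha.
apply: (@continuous_comp _ _ _ (fun w => bernstein_alpha a b w ^+ 2 - 1) Num.sqrt).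
  apply: cvgB; last exact: cvg_cst.
  apply: (@continuous_comp _ _ _ (bernstein_alpha a b) (fun x => x ^+ 2)).
    exact: continuous_bernstein_alpha.
  exact: exprn_continuous.
exact: sqrt_continuous.
Qed.

Lemma continuous_decay_factor d : continuous (decay_factor a b d).
Proof.
have cX (n : nat) : continuous (fun w => bernstein_radius a b w ^+ n).
  move=> w; apply: (@continuous_comp _ _ _ (bernstein_radius a b) (fun x => x ^+ n)).
    exact: continuous_bernstein_radius.
  exact: exprn_continuous.
move=> w; have r1 := bernstein_radius_gt1 w; have r0 := lt_trans ltr01 r1.
apply: cvgM.
  apply: cvgM; first exact: cX.
  apply: cvgV; first by rewrite expf_neq0// subr_eq0 gt_eqF// expr_gt1// ltW.
  apply: (@continuous_comp _ _ _
    (fun w => bernstein_radius a b w ^+ 2 - 1) (fun x => x ^+ 2)).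
    by apply: cvgB; [exact: cX|exact: cvg_cst].
  exact: exprn_continuous.
apply: (@continuous_comp _ _ _ (fun w => 1 / bernstein_radius a b w) (fun x => x ^+ d)).
  apply: cvgM; first exact: cvg_cst.
  by apply: cvgV; [rewrite gt_eqF|exact: continuous_bernstein_radius].
exact: exprn_continuous.
Qed.

End decay_factor.

(** The first factor decays like 1 / (a^2 + w^2) by [decay_factor_le], the second
    one is bounded. *)
Lemma integrable_decay_factorM (R : realType) (a b a' b' : R) (d d' : nat) :
  0 < a -> a < b -> 0 < a' -> a' < b' ->
  (@lebesgue_measure R).-integrable [set: R]
    (EFin \o (fun w => decay_factor a b d w * decay_factor a' b' d' w)).
Proof.
move=> a0 ab a0' ab'; have b0 := lt_trans a0 ab; have b0' := lt_trans a0' ab'.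
pose K := (b - a) ^+ 2 / 16 / a * ((b' - a') ^+ 2 / 16 / (a' * b')).
have := integrableZl measurableT K (integrable_cauchy_kernel a0).
apply: le_integrable => //.
  apply/measurable_EFinP; apply: continuous_measurable_fun => w.
  by apply: cvgM; exact: continuous_decay_factor.
move=> w _ /=; rewrite lee_fin ger0_norm; last first.
  by apply: mulr_ge0; exact: decay_factor_ge0.
apply: le_trans (ler_norm _).
rewrite (_ : K * _ =
  (b - a) ^+ 2 / 16 / (a ^+ 2 + w ^+ 2) * ((b' - a') ^+ 2 / 16 / (a' * b'))).
  apply: ler_pM; [exact: decay_factor_ge0|exact: decay_factor_ge0| |].
    apply: le_trans (decay_factor_le a0 ab d w) _.
    rewrite ler_wpM2l ?divr_ge0 ?sqr_ge0//.
    rewrite lef_pV2 ?posrE ?ltr_pwDl ?sqr_ge0 ?exprn_gt0 ?mulr_gt0//.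
    by rewrite lerD2r expr2 ler_pM2l// ltW.
  apply: le_trans (decay_factor_le a0' ab' d' w) _.
  rewrite ler_wpM2l ?divr_ge0 ?sqr_ge0//.
  rewrite lef_pV2 ?posrE ?ltr_pwDl ?sqr_ge0 ?exprn_gt0 ?mulr_gt0//.
  by rewrite lerDl sqr_ge0.
rewrite /K /cauchy_kernel; field.
by rewrite !gt_eqF ?cauchy_kernel_den_gt0.
Qed.

(** * The decay bound *)

Local Open Scope complex_scope.

(* Indices are counted from 0: k, t, i, j, l, m below are the usual 1-based
   ones minus 1, which leaves the differences i - l and j - m unchanged. *)
Theorem proposition4p2 (R : realType) (n1 n2 : nat)
    (M1 : 'M[R]_n1) (M2 : 'M[R]_n2)
    (sym1 : M1^T = M1) (pd1 : posdefmx M1) (tri1 : tridiagonal M1)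
    (sym2 : M2^T = M2) (pd2 : posdefmx M2) (tri2 : tridiagonal M2)
    (ne1 : lambda_max M1 <> lambda_min M1)
    (ne2 : lambda_max M2 <> lambda_min M2)
    (k t : 'I_(n1 * n2)) (i j l m : nat)
    (hi : i = (t %/ n2)%N) (hj : j = (t - n2 * (t %/ n2))%N)
    (hl : l = (k %/ n2)%N) (hm : m = (k - n2 * (k %/ n2))%N)
    (li : l <> i) (mj : m <> j) :
  `|invmx (kronsum M1 M2) k t| <=
    1 / (2 * pi) * (64 / delta12 M1 M2) *
    \int[lebesgue_measure]_(w in [set: R])
      (Rfun M1 w ^+ 2 / (Rfun M1 w ^+ 2 - 1) ^+ 2
       * (Rfun M2 w ^+ 2 / (Rfun M2 w ^+ 2 - 1) ^+ 2)
       * (1 / Rfun M1 w) ^+ (`|i - l| - 1)%N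
       * (1 / Rfun M2 w) ^+ (`|j - m| - 1)%N).
Proof.
have [U1 [L1 sd1]] := symmetric_spectral_data sym1.
have [U2 [L2 sd2]] := symmetric_spectral_data sym2.
pose l' := (mxtens_unindex k).1; pose m' := (mxtens_unindex k).2.
pose i' := (mxtens_unindex t).1; pose j' := (mxtens_unindex t).2.
have lE : l = l' by rewrite hl.
have iE : i = i' by rewrite hi.
have subE (x : nat) : (x - n2 * (x %/ n2) = x %% n2)%N.
  by rewrite mulnC {1}(divn_eq x n2) addKn.
have mE : m = m' by rewrite hm subE.
have jE : j = j' by rewrite hj subE.
have li' : l' != i' by apply/eqP => h; apply: li; rewrite lE iE h.
have mj' : m' != j' by apply/eqP => h; apply: mj; rewrite mE jE h.
rewrite [`|i - l|%N]distnC [`|j - m|%N]distnC lE iE mE jE {hi hj hl hm li mj lE iE mE jE}.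
set d1 := (`|l' - i'| - 1)%N; set d2 := (`|m' - j'| - 1)%N.
have n10 : (0 < n1)%N by exact: leq_trans (ltn_ord i').
have n20 : (0 < n2)%N by exact: leq_trans (ltn_ord j').
have a1 := lambda_min_gt0 sd1 n10 pd1; have a2 := lambda_min_gt0 sd2 n20 pd2.
have ab1 := lambda_min_lt_max sd1 n10 pd1 ne1.
have ab2 := lambda_min_lt_max sd2 n20 pd2 ne2.
set am1 := lambda_min M1 in a1 ab1; set aM1 := lambda_max M1 in ab1.
set am2 := lambda_min M2 in a2 ab2; set aM2 := lambda_max M2 in ab2.
pose g w := decay_factor am1 aM1 d1 w * decay_factor am2 aM2 d2 w.
have ig : (@lebesgue_measure R).-integrable [set: R] (EFin \o g).
  exact: integrable_decay_factorM.
have -> : \int[lebesgue_measure]_(w in [set: R])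
      (Rfun M1 w ^+ 2 / (Rfun M1 w ^+ 2 - 1) ^+ 2
       * (Rfun M2 w ^+ 2 / (Rfun M2 w ^+ 2 - 1) ^+ 2)
       * (1 / Rfun M1 w) ^+ d1 * (1 / Rfun M2 w) ^+ d2) =
    \int[lebesgue_measure]_w g w.
  apply: eq_Rintegral => w _; rewrite /g /decay_factor !RfunE ?ltW//.
  by rewrite [RHS]mulrACA !mulrA.
pose W (pq : 'I_n1 * 'I_n2) :=
  spectral_weight U1 l' i' pq.1 * spectral_weight U2 m' j' pq.2.
(* W may be complex; as the entry of the inverse is real, only its real part
   matters. *)
pose F w := \sum_pq complex.Re (W pq) * tensor_kernel (L1 pq.1) (L2 pq.2) w.
have L1pos p : 0 < L1 p by exact: (spectral_pos sd1).
have L2pos q : 0 < L2 q by exact: (spectral_pos sd2).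
have [iF intF] := @Rintegral_lincomb R _ _ (@lebesgue_measure R) _
  (fun pq => complex.Re (W pq))
  (fun pq => tensor_kernel (L1 pq.1) (L2 pq.2))
  (fun pq => integrable_tensor_kernel (L1pos pq.1) (L2pos pq.2)).
have ReM (z : R[i]) (x : R) : complex.Re (z * x%:C) = complex.Re z * x.
  by case: z => z1 z2 /=; rewrite mulr0 subr0.
have ReS (I : finType) (f : I -> R[i]) :
    complex.Re (\sum_i f i) = \sum_i complex.Re (f i).
  by apply: (big_morph (@complex.Re R)) => // -[? ?] [? ?].
have entryE : invmx (kronsum M1 M2) k t = 1 / (2 * pi) * \int[lebesgue_measure]_w F w.
  have := kronsum_inv_entry sd1 sd2 pd1 pd2 k t => /(congr1 (@complex.Re R)) /= ->.
  rewrite pair_big/= ReS intF mulr_sumr; apply: eq_bigr => pq _.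
  rewrite ReM integral_tensor_kernel//; move: (@pi R) (pi_gt0 R) => p p0; field.
  by rewrite !gt_eqF ?addr_gt0.
(* W pq * tensor_kernel is half the sum of the terms of the resolvent entries at
   w and -w; the two products obey the same bound, even in w. *)
have F_le w : `|F w| <= 64 / delta12 M1 M2 * g w.
  pose G1 := resolvent_entry U1 L1 l' i'; pose G2 := resolvent_entry U2 L2 m' j'.
  have FE : F w = complex.Re ((G1 w * G2 (- w) + G1 (- w) * G2 w) / 2).
    rewrite /G1 /G2 /resolvent_entry !big_distrlr/= !pair_big/= -big_split/=.
    rewrite mulr_suml ReS; apply: eq_bigr => pq _.
    rewrite -ReM tensor_kernelC//; congr complex.Re.
    rewrite [LHS]mulrA [W pq * _]mulrDr /W.
    by congr (_ / _); congr (_ + _); rewrite mulrACA.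
  pose B1 := 8 / (aM1 - am1) * decay_factor am1 aM1 d1 w.
  pose B2 := 8 / (aM2 - am2) * decay_factor am2 aM2 d2 w.
  have -> : 64 / delta12 M1 M2 * g w = B1 * B2.
    rewrite /B1 /B2 /g /delta12 -/am1 -/aM1 -/am2 -/aM2.
    move: (decay_factor am1 _ _ _) (decay_factor am2 _ _ _) => x y.
    by field; rewrite !gt_eqF ?subr_gt0.
  have h1 : `|G1 w| <= B1%:C by exact: resolvent_entry_le.
  have h2 : `|G2 w| <= B2%:C by exact: resolvent_entry_le.
  have h1N : `|G1 (- w)| <= B1%:C.
    by rewrite /B1 -decay_factorN; exact: resolvent_entry_le.
  have h2N : `|G2 (- w)| <= B2%:C.
    by rewrite /B2 -decay_factorN; exact: resolvent_entry_le.
  rewrite -lecR FE (le_trans (normc_ge_Re _))// normrM normfV normr_nat.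
  rewrite ler_pdivrMr// (le_trans (ler_normD _ _))// !normrM.
  by rewrite rmorphM mulr_natr mulr2n lerD// ler_pM.
have iF64 := integrableZl measurableT (64 / delta12 M1 M2) ig.
have p0 : 0 <= 1 / (2 * pi) :> R by rewrite divr_ge0// mulr_ge0// pi_ge0.
rewrite entryE -[leRHS]mulrA normrM (ger0_norm p0) ler_wpM2l//.
rewrite -RintegralZl// (le_trans (le_normr_Rintegral _ _))//.
apply: le_Rintegral => //; exact: integrable_norm.
Qed.
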